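(* Let $h_1,\dots,h_\ell$ be constant positive integers and $\varepsilon>0$ a constant. For all sufficiently large network sizes $N$ there is a randomized algorithm that computes a shift connection schedule $\boldsymbol{\sigma}$ on $N$ nodes, which succeeds with probability at least $\frac12$ and whose success is efficiently (polynomial time in $N$) certifiable, such that when it succeeds, for each $j\in\{1,\dots,\ell\}$ there exists an oblivious routing protocol on $\boldsymbol{\sigma}$ which guarantees throughput $\frac{1}{2h_j}(1-\varepsilon)$ and achieves maximum latency $\mathcal{O}(h_jN^{1/h_j})$, where the constant in the $\mathcal{O}(\cdot)$ depends only on $\varepsilon$ and on the least common multiple of $h_1,\dots,h_\ell$.
   Context: A connection schedule on $N$ nodes with period $T$ is a sequence of permutations $\sigma_0,\dots,\sigma_{T-1}$ of the node set; indices are taken mod $T$. A shift connection schedule identifies the node set with $\mathbb{Z}/(N)$ and is given by shifts $s_0,\dots,s_{T-1}\in\mathbb{Z}/(N)$ with $\sigma_k(j)=j+s_k$. The virtual topology is the directed graph on $[N]\times\mathbb{Z}$ with virtual edges $(i,t)\to(i,t+1)$ and physical edges $(i,t)\to(\sigma_t(i),t+1)$. A flow is a nonnegative measure on directed paths of this graph; it is $T$-periodic if invariant under shifting all times by $T$; it is feasible if every physical edge is contained in paths of total measure at most $1$ (virtual edges unlimited). An oblivious routing protocol is a $T$-periodic flow $R$ such that for every $(a,b,t)$ the total flow on paths from $(a,t)$ to some $(b,t')$, $t'>t$, equals $1$. The latency of a path is its number of edges; the maximum latency of $R$ is the maximum latency over paths with positive flow. For a demand function $D:[N]\times[N]\times\mathbb{Z}\to\mathbb{R}_{\ge0}$,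 the induced flow $R^D$ assigns to each path $P$ starting at $(a,t)$ and ending at node $b$ the value $D(a,b,t)R(P)$. $R$ guarantees throughput $r$ if $R^D$ is feasible for all $D$ with $\sum_b D(a,b,t)\le r$ and $\sum_b D(b,a,t)\le r$ for all $a,t$. *)

(* Defs.v *)
From HB Require Import structures.
From mathcomp Require Import all_boot all_order all_algebra all_fingroup.
From mathcomp Require Import all_classical all_reals all_analysis.

Set Implicit Arguments.
Unset Strict Implicit.
Unset Printing Implicit Defensive.

Import Order.TTheory GRing.Theory Num.Theory.
Local Open Scope classical_set_scope.
Local Open Scope ring_scope.

(** * Connection schedules and their virtual topology *)

(** A connection schedule of period [size sigma] on the node set [V]; only
    nonempty sequences are meaningful.  [conn] reads it at any time [t : int],
    modulo the period. *)
Definition schedule (V : finType) := seq {perm V}.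

Definition conn (V : finType) (sigma : schedule V) (t : int) : {perm V} :=
  nth 1%g sigma `|(t %% (size sigma)%:Z)%Z|%N.

(** Nodes are the elements of ['Z_N], so [1 < N] is needed for this to be a
    schedule on [N] nodes. *)
Definition shift_schedule (N : nat) (s : seq 'Z_N) : schedule 'Z_N :=
  [seq perm (addIr x) | x <- s].

Section Topology.
Variables (V : finType) (sigma : schedule V).

Definition vertex : Type := (V * int)%type.

(** An edge is its source together with its kind: [true] for the physical edge
    leaving that vertex, [false] for the virtual one.  The two stay distinct
    even where [sigma] fixes a node. *)
Definition edge : Type := (vertex * bool)%type.

Definition edge_tgt (e : edge) : vertex :=
  let: ((i, t), physical) := e in
  ((if physical then conn sigma t i else i), t + 1).

(** A finite directed path of the virtual topology is determined by its first
    vertex and the kinds of its successive edges. *)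
Definition dipath : Type := (vertex * seq bool)%type.

Fixpoint edges_from (v : vertex) (ks : seq bool) : seq edge :=
  if ks is k :: ks' then (v, k) :: edges_from (edge_tgt (v, k)) ks' else [::].

Definition path_edges (p : dipath) : seq edge := edges_from p.1 p.2.

Definition path_src (p : dipath) : vertex := p.1.

Definition path_tgt (p : dipath) : vertex :=
  foldl (fun v k => edge_tgt (v, k)) p.1 p.2.

Definition latency (p : dipath) : nat := size (path_edges p).

Definition time_shift (d : int) (p : dipath) : dipath :=
  ((p.1.1, p.1.2 + d), p.2).

(** * Flows and oblivious routing *)

Variable R : realType.

(** There are countably many paths, so a measure on paths is given by its
    point masses; the measure of a set of paths is an [\esum]. *)
Definition is_flow (f : dipath -> R) : Prop := forall p, 0 <= f p.

Definition periodic (f : dipath -> R) : Prop :=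
  forall p, f (time_shift (size sigma)%:Z p) = f p.

Definition feasible (f : dipath -> R) : Prop :=
  forall v : vertex,
    (\esum_(p in [set p | (v, true) \in path_edges p]) (f p)%:E <= 1)%E.

Definition paths_between (a b : V) (t : int) : set dipath :=
  [set p | path_src p = (a, t) /\
           exists t' : int, t < t' /\ path_tgt p = (b, t')].

Definition oblivious_routing_protocol (f : dipath -> R) : Prop :=
  [/\ is_flow f, periodic f &
      forall (a b : V) (t : int),
        (\esum_(p in paths_between a b t) (f p)%:E = 1)%E].

Definition max_latency_le (f : dipath -> R) (x : R) : Prop :=
  forall p, 0 < f p -> (latency p)%:R <= x.

Definition induced_flow (f : dipath -> R) (D : V -> V -> int -> R)
    (p : dipath) : R :=
  D (path_src p).1 (path_tgt p).1 (path_src p).2 * f p.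

Definition guarantees_throughput (f : dipath -> R) (r : R) : Prop :=
  forall D : V -> V -> int -> R,
    (forall a b t, 0 <= D a b t) ->
    (forall a t, \sum_b D a b t <= r) ->
    (forall a t, \sum_b D b a t <= r) ->
    feasible (induced_flow f D).

End Topology.

(** * Randomized RAM programs

    Structured programs on a random access machine with a bank of registers, a
    heap, and a stream of fair coins.  Every elementary command and every test
    has unit cost.  There is no multiplication, so [t] steps produce numbers of
    only [O(t)] more bits than the input, and polynomial time here is
    polynomial time on Turing machines. *)

Inductive expr :=
  | ECst of nat
  | EReg of nat
  | EMem of expr
  | EAdd of expr & expr
  | ESub of expr & expr.

Inductive prog :=
  | PSkip
  | PSet of nat & expr
  | PStore of expr & expr
  | PFlip of nat
  | PSeq of prog & prog
  | PIf of expr & prog & prog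
  | PWhile of expr & prog.

Record state := State { regs : nat -> nat; heap : nat -> nat; coins : seq bool }.

Fixpoint eval (st : state) (e : expr) : nat :=
  match e with
  | ECst n => n
  | EReg x => regs st x
  | EMem e1 => heap st (eval st e1)
  | EAdd e1 e2 => (eval st e1 + eval st e2)%N
  | ESub e1 e2 => (eval st e1 - eval st e2)%N
  end.

Definition upd (f : nat -> nat) (x v : nat) : nat -> nat :=
  fun y => if y == x then v else f y.

Definition set_reg (st : state) (x v : nat) : state :=
  State (upd (regs st) x v) (heap st) (coins st).

Definition set_heap (st : state) (a v : nat) : state :=
  State (regs st) (upd (heap st) a v) (coins st).

(** [exec c st t st'] : run from [st], the program [c] halts in [st'] after
    exactly [t] steps.  A coin flip with no coin left is stuck, and the guard
    of a test holds when it is nonzero. *)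
Inductive exec : prog -> state -> nat -> state -> Prop :=
  | ExSkip st : exec PSkip st 1 st
  | ExSet st x e : exec (PSet x e) st 1 (set_reg st x (eval st e))
  | ExStore st e1 e2 :
      exec (PStore e1 e2) st 1 (set_heap st (eval st e1) (eval st e2))
  | ExFlip r h b w x :
      exec (PFlip x) (State r h (b :: w)) 1 (set_reg (State r h w) x b)
  | ExSeq c1 c2 st1 st2 st3 t1 t2 :
      exec c1 st1 t1 st2 -> exec c2 st2 t2 st3 ->
      exec (PSeq c1 c2) st1 (t1 + t2)%N st3
  | ExIfT e c1 c2 st t st' :
      eval st e != 0%N -> exec c1 st t st' -> exec (PIf e c1 c2) st t.+1 st'
  | ExIfF e c1 c2 st t st' :
      eval st e = 0%N -> exec c2 st t st' -> exec (PIf e c1 c2) st t.+1 st'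
  | ExWhileF e c st : eval st e = 0%N -> exec (PWhile e c) st 1 st
  | ExWhileT e c st1 st2 st3 t1 t2 :
      eval st1 e != 0%N -> exec c st1 t1 st2 ->
      exec (PWhile e c) st2 t2 st3 ->
      exec (PWhile e c) st1 (t1 + t2).+1 st3.

(** The program [A], given [N] in register 0 and the coins [w], halts with a
    nonempty sequence of shifts [s]: its length is in register 1 and its
    entries, as numbers below [N], are in the first heap cells. *)
Definition computes_shifts (A : prog) (N : nat) (w : seq bool) (s : seq 'Z_N)
    : Prop :=
  exists (t : nat) (st : state),
    [/\ exec A (State (upd (fun=> 0%N) 0 N) (fun=> 0%N) w) t st,
        (0 < size s)%N, regs st 1 = size s &
        forall i, (i < size s)%N -> heap st i = nth 0 s i :> nat].

(** The program [B], given [N], the length of [s] and [s] in the same layout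
    but no coins, so deterministically, halts after [t] steps with verdict [b],
    which is whether register 0 is nonzero. *)
Definition decides (B : prog) (N : nat) (s : seq 'Z_N) (t : nat) (b : bool)
    : Prop :=
  exists st : state,
    exec B (State (upd (upd (fun=> 0%N) 0 N) 1 (size s))
                  (fun i => nth 0 s i : nat) [::]) t st
    /\ b = (regs st 0 != 0%N).

Definition accepts (B : prog) (N : nat) (s : seq 'Z_N) : Prop :=
  exists t, decides B s t true.

(* Main.v *)
Require Import Defs.
From HB Require Import structures.
From mathcomp Require Import all_boot all_order all_algebra all_fingroup.
From mathcomp Require Import all_classical all_reals all_analysis.
From mathcomp Require Import zify ring lra.

(* Let m = ceil (N^(1/L)) and M = m^L.  At time t = tau L + q, with q < L, the
   schedule uses the shift rot_q(tau) mod N, where rot_q rotates the L base-m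
   digits of tau cyclically by q places.  Fix h dividing L and put g = L/h.  In
   an aligned window of L m^g slots only the g low digits of tau vary, so the
   slots of direction q sweep, up to a fixed translate, the digit positions
   q, ..., q+g-1 (mod L).  Hence, for each r < g, taking one hop in each of the
   directions r, r+g, ..., r+(h-1)g reaches every number below M exactly once,
   and altogether every slot is used equally often.  Keeping only the choices
   whose sum is below N makes the displacement exactly uniform on Z/N and
   raises the load by at most M/N, which tends to 1.

   Routing is Valiant's: wait for the next window, spread uniformly in it, and
   deliver in the window after it; each phase loads an edge by r h M/N.

   The schedule being explicit, the sampler needs no coin, and the certifier
   recomputes the schedule and compares. *)

Set Implicit Arguments.
Unset Strict Implicit.
Unset Printing Implicit Defensive.

Import Order.TTheory GRing.Theory Num.Theory.
Local Open Scope classical_set_scope.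
Local Open Scope ring_scope.

(** The infinite sum is exchanged with the finite one; each point mass then leaves a sum over at
    most one path. *)
Lemma esum_point_masses (R : realType) (T : choiceType) (I : finType)
    (F : I -> T) (c : I -> R) (S : set T) : (forall i, 0 <= c i) ->
  (\esum_(p in S) (\sum_i (if F i == p then c i else 0))%:E =
   (\sum_i (if `[< S (F i) >] then c i else 0))%:E)%E.
Proof.
move=> c0.
under eq_esum do rewrite -sumEFin.
rewrite esum_sum => [|p i _ _]; last by rewrite lee_fin; case: ifP.
rewrite -sumEFin; apply: eq_bigr => i _; case: asboolP => [Si|nSi].
  rewrite esum_mkcond (_ : (fun p => _) =
      (fun p => if p \in [set F i] then (c i)%:E else 0%E)).
    by rewrite -esum_mkcond esum_set1// lee_fin.
  apply/funext => p; case: eqP => [<-|Fip].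
    by rewrite (mem_set Si) mem_set.
  rewrite (memNset (A := [set F i])) => [|e]; last by apply: Fip.
  by case: ifP.
by rewrite esum1// => p Sp; case: eqP => // e; case: nSi; rewrite e.
Qed.

(** * Edges and endpoints of concatenated paths *)

Section Paths.
Variables (V : finType) (sigma : schedule V).

Definition endpoint (v : vertex V) (ks : seq bool) : vertex V :=
  path_tgt sigma (v, ks).

Lemma edges_from_cat v ks1 ks2 :
  edges_from sigma v (ks1 ++ ks2) =
  edges_from sigma v ks1 ++ edges_from sigma (endpoint v ks1) ks2.
Proof. by elim: ks1 v => //= k ks1 IH v; rewrite IH. Qed.

Lemma size_edges_from v ks : size (edges_from sigma v ks) = size ks.
Proof. by elim: ks v => //= k ks IH v; rewrite IH. Qed.

Lemma physical_edges_from_virtual v u n :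
  ((u, true) \in edges_from sigma v (nseq n false)) = false.
Proof.
elim: n v => //= n IH v; rewrite inE IH orbF.
by apply/eqP => -[].
Qed.

Lemma mem_edges_from v u ks :
  ((u, true) \in edges_from sigma v ks) =
  has (fun j => nth false ks j && (u == endpoint v (take j ks)))
    (iota 0 (size ks)).
Proof.
elim: ks v => //= k ks IH v; rewrite inE IH -[1%N]add1n iotaDl has_map.
rewrite xpair_eqE [true == k]eq_sym andbC; congr (_ || _); first by case: k.
Qed.

End Paths.

(** * Paths under a shift schedule *)

Section Shifts.
Variables (N : nat) (s : seq 'Z_N).
Hypothesis s_gt0 : (0 < size s)%N.
Notation sigma := (shift_schedule s).

Definition shift_at (t : int) : 'Z_N := nth 0 s `|(t %% (size s)%:Z)%Z|%N.

Lemma conn_shift t x : conn sigma t x = x + shift_at t.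
Proof.
rewrite /conn size_map (nth_map 0) ?permE//.
by rewrite -ltz_nat gez0_abs ?modz_ge0 ?ltz_pmod //; case: (size s) s_gt0.
Qed.

(** Under shifts, the displacement along a path depends on its start time and edge kinds but not on
    its start node. *)
Fixpoint disp (t : int) (ks : seq bool) : 'Z_N :=
  if ks is k :: ks' then (if k then shift_at t else 0) + disp (t + 1) ks'
  else 0.

Lemma endpoint_shift a t ks :
  endpoint sigma (a, t) ks = (a + disp t ks, t + (size ks)%:Z).
Proof.
elim: ks a t => [|k ks IH] a t /=; first by rewrite !addr0.
rewrite /endpoint/path_tgt/= in IH *.
rewrite IH; congr (_, _); last by lia.
by rewrite addrA; case: k; rewrite ?addr0 // conn_shift.
Qed.

Lemma disp_cat t ks1 ks2 :
  disp t (ks1 ++ ks2) = disp t ks1 + disp (t + (size ks1)%:Z) ks2.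
Proof.
clear s_gt0; elim: ks1 t => [|k ks1 IH] t /=; first by rewrite add0r addr0.
by rewrite IH addrA; congr (_ + disp _ _); lia.
Qed.

Lemma disp_virtual t n : disp t (nseq n false) = 0.
Proof. by elim: n t => //= n IH t; rewrite IH addr0. Qed.

Lemma disp_sum t ks :
  disp t ks = \sum_(j < size ks) if nth false ks j then shift_at (t + j%:Z) else 0.
Proof.
clear s_gt0; elim: ks t => [|k ks IH] t /=; first by rewrite big_ord0.
rewrite big_ord_recl /= addr0 IH; congr (_ + _).
by apply: eq_bigr => j _; rewrite /bump /= (_ : t + 1 + _ = t + (1 + j)%N)//; lia.
Qed.

(** Each edge advances time by one, so [u - t] is the only position at which the edge can be
    crossed. *)
Lemma mem_edges_shift a t x u ks :
  (((x, u), true) \in edges_from sigma (a, t) ks) =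
  [&& t <= u < t + (size ks)%:Z, nth false ks `|u - t|%N &
      x == a + disp t (take `|u - t|%N ks)].
Proof.
rewrite mem_edges_from; apply/hasP/and3P => [[j]|[ut kj /eqP xE]].
  rewrite mem_iota add0n => /andP[_ jk] /andP[kj].
  rewrite endpoint_shift size_take jk => /eqP[-> ->].
  rewrite (_ : absz (t + j%:Z - t)%R = j); last by lia.
  by rewrite eqxx kj; split=> //; lia.
have uj : (`|u - t| < size ks)%N by move/andP: ut; lia.
exists `|u - t|%N; first by rewrite mem_iota add0n.
rewrite kj endpoint_shift size_take uj xE /=; apply/eqP; congr (_, _).
by move/andP: ut; lia.
Qed.

End Shifts.

(** * Valiant load balancing in windows *)

(* A choice [w] in [A] selects the slots [sel w] of a window, and the resulting
   displacement [block_sum] takes every value for exactly [K] choices. *)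
Section Routing.
Variables (R : realType) (N : nat) (s : seq 'Z_N) (P : nat).
Variables (Om : finType) (A : {pred Om}) (sel : Om -> nat -> bool) (K : nat).
Hypotheses (N_gt1 : (1 < N)%N) (s_gt0 : (0 < size s)%N) (P_gt0 : (0 < P)%N).
Hypotheses (P_dvd : (P %| size s)%N) (K_gt0 : (0 < K)%N).
Notation sigma := (shift_schedule s).

Definition block (w : Om) : seq bool := mkseq (sel w) P.

Lemma size_block w : size (block w) = P.
Proof. exact: size_mkseq. Qed.

Definition block_sum (k : int) (w : Om) : 'Z_N := disp s (k * P%:Z) (block w).

Hypothesis block_sumE :
  forall k z, #|[pred w in A | block_sum k w == z]| = K.

Lemma sum_block_sum k (phi : 'Z_N -> R) :
  \sum_(w in A) phi (block_sum k w) = K%:R * \sum_z phi z.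
Proof.
rewrite (partition_big (block_sum k) predT) //= mulr_sumr.
apply: eq_bigr => z _; rewrite -(block_sumE k z) -sum1_card natr_sum mulr_suml.
rewrite [RHS](eq_bigl (fun w => (w \in A) && (block_sum k w == z))).
  by apply: eq_bigr => w /andP[_ /eqP->]; rewrite mul1r.
by move=> w; rewrite inE.
Qed.

Lemma card_A : #|A|%:R = K%:R * N%:R :> R.
Proof.
have := sum_block_sum 0 (fun=> 1); rewrite !sumr_const => ->.
by rewrite card_ord Zp_cast.
Qed.

(** For a fixed source and destination, [K * #|A|], that is [K ^ 2 * N], pairs of choices make the
    delivery; this weight brings their total to 1. *)
Let wt : R := (K%:R ^+ 2 * N%:R)^-1.
Let pair_weight (w : Om * Om) : R :=
  if (w.1 \in A) && (w.2 \in A) then wt else 0.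

(** At a window boundary the wait lasts a whole window, so the two phases always occupy the windows
    numbered [t %/ P + 1] and [t %/ P + 2]. *)
Let kinds (t : int) (w : Om * Om) : seq bool :=
  nseq (P - absz (t %% P%:Z)%Z) false ++ block w.1 ++ block w.2.

(** A path collects the weights of all pairs of choices that produce it. *)
Definition vlb (p : dipath 'Z_N) : R :=
  \sum_w (if (p.1, kinds p.1.2 w) == p then pair_weight w else 0).

Let wt_ge0 : 0 <= wt.
Proof. by rewrite invr_ge0 mulr_ge0 // exprn_ge0. Qed.

Let pair_weight_ge0 w : 0 <= pair_weight w.
Proof. by rewrite /pair_weight; case: ifP. Qed.

Let modP_lt (t : int) : (absz (t %% P%:Z)%Z < P)%N.
Proof. by rewrite -ltz_nat gez0_abs ?modz_ge0 ?ltz_pmod //; case: P P_gt0. Qed.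

Let size_kinds t w : size (kinds t w) = (P - absz (t %% P%:Z)%Z + P + P)%N.
Proof. by rewrite /kinds !size_cat !size_block size_nseq addnA. Qed.

Let start_phase1 (t : int) :
  t + (size (nseq (P - absz (t %% P%:Z)%Z) false))%:Z =
  ((t %/ P%:Z)%Z + 1) * P%:Z.
Proof.
rewrite size_nseq; have := modP_lt t.
rewrite {2}(divz_eq t P%:Z) mulrDl mul1r => /ltnW h.
rewrite -subzn // gez0_abs; last by rewrite modz_ge0 //; lia.
by lia.
Qed.

Let disp_kinds t w :
  disp s t (kinds t w) =
    block_sum ((t %/ P%:Z)%Z + 1) w.1 + block_sum ((t %/ P%:Z)%Z + 2) w.2.
Proof.
rewrite /kinds disp_cat. rewrite disp_virtual add0r start_phase1 disp_cat size_block.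
by congr (_ + disp _ _ _); lia.
Qed.

Let mem_block a k w x (u : int) :
  (((x, u), true) \in edges_from sigma (a, k * P%:Z) (block w)) =
  [&& k == (u %/ P%:Z)%Z, sel w (absz (u %% P%:Z)%Z) &
      x == a + disp s (k * P%:Z) (take (absz (u %% P%:Z)%Z) (block w))].
Proof.
rewrite mem_edges_shift // size_block.
have PP : P%:Z != 0 by lia.
have [/eqP e|ne] := boolP (k == (u %/ P%:Z)%Z); last first.
  apply/negP => /and3P[/andP[h1 h2] _ _]; case/negP: ne; apply/eqP.
  rewrite (_ : u = k * P%:Z + (u - k * P%:Z)); last by lia.
  by rewrite divzMDl // divz_small ?addr0 //; lia.
have hu : (u - k * P%:Z)%R = (u %% P%:Z)%Z by rewrite e; lia.
have -> : absz (u - k * P%:Z)%R = absz (u %% P%:Z)%Z by rewrite hu.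
rewrite nth_mkseq ?modP_lt //.
have := modz_ge0 u PP; have := modP_lt u; move: hu.
move: (u %% P%:Z)%Z => m hu m1 m2.
by rewrite (_ : (_ <= u < _) = true) //; lia.
Qed.

Let mem_kinds a t w x (u : int) (k := (t %/ P%:Z)%Z) (k' := (u %/ P%:Z)%Z)
    (o := absz (u %% P%:Z)%Z) :
  (((x, u), true) \in edges_from sigma (a, t) (kinds t w)) =
  [&& k + 1 == k', sel w.1 o &
      x == a + disp s (k' * P%:Z) (take o (block w.1))] ||
  [&& k + 2 == k', sel w.2 o &
      x == a + block_sum (k + 1) w.1 + disp s (k' * P%:Z) (take o (block w.2))].
Proof.
rewrite /kinds edges_from_cat mem_cat physical_edges_from_virtual /=.
rewrite endpoint_shift // disp_virtual addr0 start_phase1 edges_from_cat mem_cat.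
rewrite endpoint_shift // size_block -/k.
rewrite (_ : (k + 1) * P%:Z + P%:Z = (k + 2) * P%:Z); last by lia.
rewrite !mem_block -/k' -/o.
by congr (_ || _); case: eqP => [->|].
Qed.

(** Reduces a sum over a possibly infinite set of paths to a finite one: inside [S] the flow lives
    on the sources listed by [src], and each source has finitely many choices. *)
Let esum_vlb (J : finType) (src : J -> vertex 'Z_N) (g : dipath 'Z_N -> R)
    (S : set (dipath 'Z_N)) :
  injective src -> (forall p, 0 <= g p) ->
  (forall p, S p -> (forall j, src j != p.1) -> vlb p = 0) ->
  (\esum_(p in S) (g p * vlb p)%:E =
   (\sum_j \sum_w let p := (src j, kinds (src j).2 w) in
      if `[< S p >] then g p * pair_weight w else 0)%:E)%E.
Proof.
move=> src_inj g0 Sout.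
pose F (i : J * (Om * Om)) : dipath 'Z_N := (src i.1, kinds (src i.1).2 i.2).
rewrite (eq_esum (b := fun p =>
    (\sum_i (if F i == p then g (F i) * pair_weight i.2 else 0))%:E)).
  rewrite esum_point_masses => [|i]; last by rewrite mulr_ge0.
  by rewrite pair_bigA.
move=> p Sp; congr (_%:E).
rewrite -(pair_bigA _ (fun j w =>
  if F (j, w) == p then g (F (j, w)) * pair_weight w else 0)) /=.
have [[j /eqP jp]|none] := pselect (exists j, src j == p.1); last first.
  rewrite Sout // => [|j]; last by apply/eqP => e; apply: none; exists j; apply/eqP.
  rewrite mulr0 big1 // => j _; rewrite big1 // => w _.
  by case: eqP => // e; case: none; exists j; rewrite -e eqxx.
rewrite (bigD1 j) //= [X in _ + X]big1 ?addr0 => [|i ij]; last first.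
  rewrite big1 // => w _; case: eqP => // e; case/eqP: ij.
  by apply: src_inj; rewrite jp -e.
rewrite /vlb mulr_sumr; apply: eq_bigr => w _; rewrite /F /= jp.
by case: eqP => [->|]; rewrite ?mulr0.
Qed.

Let vlb_ge0 : is_flow vlb.
Proof. by move=> p; apply: sumr_ge0 => w _; case: ifP. Qed.

Let vlb_periodic : Defs.periodic sigma vlb.
Proof.
case=> -[a t] ks; rewrite /Defs.periodic /vlb /time_shift /=.
have -> : ((size sigma)%:Z = (size s %/ P)%N%:Z * P%:Z) by rewrite size_map -PoszM divnK.
apply: eq_bigr => w _; rewrite /kinds.
rewrite (_ : (t + _ * P%:Z) %% P%:Z = t %% P%:Z)%Z; last first.
  by rewrite addrC modzMDl.
by rewrite !xpair_eqE !eqxx.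
Qed.

Let K2N_neq0 : K%:R ^+ 2 * N%:R != 0 :> R.
Proof. by rewrite mulf_neq0 ?expf_neq0 ?pnatr_eq0 //; lia. Qed.

Let sum_pair_weight (G : Om * Om -> R) :
  \sum_w G w * pair_weight w =
  wt * \sum_(w1 in A) \sum_(w2 in A) G (w1, w2).
Proof.
rewrite pair_big mulr_sumr [RHS]big_mkcond; apply: eq_bigr => -[w1 w2] _ /=.
by rewrite /pair_weight /= mulrC; case: ifP => //; rewrite mul0r.
Qed.

Let path_tgt_kinds a t w :
  path_tgt sigma ((a, t), kinds t w) =
  (a + (block_sum ((t %/ P%:Z)%Z + 1) w.1 + block_sum ((t %/ P%:Z)%Z + 2) w.2),
   t + (size (kinds t w))%:Z).
Proof. by rewrite -/(endpoint _ _ _) endpoint_shift // disp_kinds. Qed.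

(** Whatever the first choice, exactly [K] second choices complete the displacement to [b - a], so
    the total weight is [wt * #|A| * K], which is 1. *)
Lemma vlb_protocol : oblivious_routing_protocol sigma vlb.
Proof.
split=> // a b t.
rewrite (eq_esum (b := fun p => (1 * vlb p)%:E)); last by move=> p _; rewrite mul1r.
rewrite (esum_vlb (J := unit) (src := fun=> (a, t))) //; last first.
- by move=> p [/= pa _] /(_ tt); rewrite -pa eqxx.
- by case=> [[]].
congr (_%:E); rewrite (bigD1 tt) //= [X in _ + X]big1 ?addr0 => [|[]//].
(* The indicator that the two displacements lead from [a] to [b]. *)
pose c z1 z2 := (z2 == b - (a + z1))%:R : R.
set k := (t %/ P%:Z)%Z.
rewrite (eq_bigr (fun w =>
    c (block_sum (k + 1) w.1) (block_sum (k + 2) w.2) * pair_weight w)).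
  rewrite sum_pair_weight /=.
  rewrite (eq_bigr (fun=> K%:R)) => [|w1 _]; last first.
    rewrite (sum_block_sum _ (c _)) (bigD1 (b - (a + block_sum (k + 1) w1))) //=.
    rewrite big1 ?addr0 => [|z /negbTE zb]; last by rewrite /c zb.
    by rewrite /c eqxx mulr1.
  by rewrite sumr_const -[_ *+ _]mulr_natr card_A [K%:R * _]mulrA -expr2 mulVf.
move=> w _; rewrite mul1r /c.
have -> : `[< paths_between sigma a b t ((a, t), kinds t w) >] =
          (block_sum (k + 2) w.2 == b - (a + block_sum (k + 1) w.1)).
  apply/asboolP/eqP => [[_ [t' [_]]]|e].
    by rewrite path_tgt_kinds => -[<- _]; rewrite [a + (_ + _)]addrA [RHS]addrC addKr.
  split=> //; exists (t + (size (kinds t w))%:Z); split.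
    by rewrite size_kinds; lia.
  by rewrite path_tgt_kinds e addrA [X in (X, _)]addrC subrK.
by case: eqP => _; rewrite ?mul1r ?mul0r.
Qed.

(** The wait takes at most [P] edges and each of the two phases exactly [P]. *)
Lemma vlb_latency : max_latency_le sigma vlb (3 * P)%:R.
Proof.
case=> v ks; rewrite /vlb /latency /path_edges size_edges_from /= => f_gt0.
suff [w /eqP [<-]] : exists w, (v, kinds v.2 w) == (v, ks).
  by rewrite ler_nat size_kinds; have := modP_lt v.2; lia.
apply/not_existsP => none; move: f_gt0; rewrite big1 ?ltxx // => w _.
by case: ifP => // /none.
Qed.

Let vlb_supp a t ks : vlb ((a, t), ks) != 0 -> exists w, ks = kinds t w.
Proof.
move=> nz; apply/not_existsP => none; case/eqP: nz.
by rewrite /vlb big1 // => w _; case: eqP => // -[e]; case: (none w).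
Qed.

(** * Load of one edge from the paths with a given start time *)

Section Load.
Variables (r : R) (D : 'Z_N -> 'Z_N -> R) (c1 c2 : int) (o : nat) (x : 'Z_N).
Variable G : Om -> 'Z_N.
Hypotheses (D_ge0 : forall a b, 0 <= D a b).
Notation bs := block_sum.
Let cnt := #|[pred w in A | sel w o]|.

Let bound_sum (H : Om -> R) :
  (forall w, w \in A -> H w <= (if sel w o then K%:R * r else 0)) ->
  wt * \sum_(w in A) H w <= wt * (cnt%:R * (K%:R * r)).
Proof.
move=> Hle; apply: ler_wpM2l => //; apply: le_trans (ler_sum _ Hle) _.
rewrite -big_mkcondr /= (eq_bigl (mem [pred w in A | sel w o])).
  by rewrite sumr_const (mulr_natl (_ * _)) ?lexx.
by move=> w; rewrite !inE.
Qed.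

(** For each pair of choices exactly one start node, [x - g w1 w2], leads through [x], so the sum
    over start nodes has one term. *)
Let collapse (p : Om -> Om -> bool) (g : Om -> Om -> 'Z_N)
    (e : 'Z_N -> Om -> Om -> 'Z_N) :
  \sum_a \sum_w (if p w.1 w.2 && (x == a + g w.1 w.2)
     then D a (e a w.1 w.2) * pair_weight w else 0) =
  wt * \sum_(w1 in A) \sum_(w2 in A)
     (if p w1 w2 then D (x - g w1 w2) (e (x - g w1 w2) w1 w2) else 0).
Proof.
rewrite exchange_big /= -(sum_pair_weight (fun w =>
  if p w.1 w.2 then D (x - g w.1 w.2) (e (x - g w.1 w.2) w.1 w.2) else 0)).
apply: eq_bigr => w _; rewrite (bigD1 (x - g w.1 w.2)) //= subrK eqxx andbT.
rewrite big1 ?addr0 => [|a ax]; last first.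
  by rewrite -subr_eq [_ == a]eq_sym (negbTE ax) andbF.
by case: (p _ _); rewrite ?mul0r.
Qed.

(** The first choice fixes the start node; the second spreads the destination uniformly, which
    yields [K] times a row sum of [D]. *)
Lemma load_phase1 : (forall a, \sum_b D a b <= r) ->
  \sum_a \sum_w (if sel w.1 o && (x == a + G w.1)
     then D a (a + (bs c1 w.1 + bs c2 w.2)) * pair_weight w else 0)
  <= wt * (cnt%:R * (K%:R * r)).
Proof.
move=> Dr.
rewrite (collapse (fun w1 _ => sel w1 o) (fun w1 _ => G w1)
  (fun a w1 w2 => a + (bs c1 w1 + bs c2 w2))).
apply: bound_sum => w _; case: ifP => _; last by rewrite big1.
set a := x - G w.
rewrite (sum_block_sum c2 (fun z => D a (a + (bs c1 w + z)))).
rewrite ler_wpM2l //; apply: le_trans (Dr a).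
rewrite [leRHS](reindex_inj (addrI (a + bs c1 w))) /=.
by under [leRHS]eq_bigr do rewrite -addrA.
Qed.

(** Here the second choice fixes the destination and the first spreads the start node uniformly,
    which yields [K] times a column sum of [D]. *)
Lemma load_phase2 : (forall b, \sum_a D a b <= r) ->
  \sum_a \sum_w (if sel w.2 o && (x == a + (bs c1 w.1 + G w.2))
     then D a (a + (bs c1 w.1 + bs c2 w.2)) * pair_weight w else 0)
  <= wt * (cnt%:R * (K%:R * r)).
Proof.
move=> Dr.
rewrite (collapse (fun _ w2 => sel w2 o) (fun w1 w2 => bs c1 w1 + G w2)
  (fun a w1 w2 => a + (bs c1 w1 + bs c2 w2))).
rewrite exchange_big /=.
apply: bound_sum => w _; case: ifP => _; last by rewrite big1.
rewrite (eq_bigr (fun w1 => D (x - G w - bs c1 w1) (x - G w + bs c2 w))).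
  rewrite (sum_block_sum c1 (fun z => D (x - G w - z) (x - G w + bs c2 w))).
  rewrite ler_wpM2l //; apply: le_trans (Dr (x - G w + bs c2 w)).
  by rewrite [leRHS](reindex_inj (subrI (x - G w))).
by move=> w1 _; congr (D _ _); ring.
Qed.

End Load.

(** An edge in window [k] serves phase one of paths started in window [k - 1] and phase two of those
    started in window [k - 2]. Each of these [2 * P] start times loads it by at most
    [cnt * r / (K * N)]. *)
Lemma vlb_throughput (r : R) :
  (forall o, (o < P)%N ->
     2 * (P * #|[pred w in A | sel w o]|)%:R * r <= (K * N)%:R) ->
  guarantees_throughput sigma vlb r.
Proof.
move=> load D D_ge0 D_out D_in [x u].
set k := (u %/ P%:Z)%Z; set o := absz (u %% P%:Z)%Z.
(* The boolean tells the phase (true for phase two), the ordinal the offset of the start time in its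
   window. *)
pose J : finType := (bool * 'I_P * 'Z_N)%type.
pose src (j : J) : vertex 'Z_N :=
  (j.2, (k - (if j.1.1 then 2 else 1)) * P%:Z + (j.1.2 : nat)%:Z).
have srcdiv (j : J) : ((src j).2 %/ P%:Z)%Z = k - (if j.1.1 then 2 else 1).
  have PP : P%:Z != 0 by lia.
  rewrite /src /= divzMDl // divz_small ?addr0 // lez_nat leq0n /=.
  by rewrite ltz_nat ltn_ord.
rewrite (eq_esum (b := fun p =>
  (D (path_src p).1 (path_tgt sigma p).1 (path_src p).2 * vlb p)%:E)) //.
rewrite (esum_vlb (J := J) (src := src)) //; first last.
- case=> -[a t] ks inS nosrc; apply/eqP/negPn/negP => /vlb_supp [w e].
  move: inS; rewrite /= /path_edges /= e mem_kinds.
  have PP : P%:Z != 0 by lia.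
  have tm := modP_lt t; have tp := modz_ge0 t PP.
  have te := divz_eq t P%:Z.
  case/orP => /and3P[/eqP tk _ _].
    apply/negP: (nosrc (false, Ordinal tm, a)).
    apply/negPn/eqP; congr (_, _); rewrite /= gez0_abs // {2}te.
    by rewrite (_ : (t %/ P)%Z = k - 1)//; lia.
  apply/negP: (nosrc (true, Ordinal tm, a)).
  apply/negPn/eqP; congr (_, _); rewrite /= gez0_abs // {2}te.
  by rewrite (_ : (t %/ P)%Z = k - 2)//; lia.
- move=> j1 j2 e; have := srcdiv j1; rewrite e srcdiv => eb.
  move: e eb; case: j1 => -[b1 i1] a1; case: j2 => -[b2 i2] a2 [-> e] /= eb.
  have eqb : b1 = b2 by case: b1 b2 eb {e} => -[] //; lia.
  rewrite -eqb in e *; congr (_, _, _); apply/val_inj => /=.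
  by move: e => /addrI [].
pose cnt := #|[pred w in A | sel w o]|.
pose G w := disp s (k * P%:Z) (take o (block w)).
pose tk (bi : bool * 'I_P) := k - (if bi.1 then 2 else 1).
pose body (bi : bool * 'I_P) a := \sum_w
  (if (if bi.1 then sel w.2 o && (x == a + (block_sum (k - 1) w.1 + G w.2))
       else sel w.1 o && (x == a + G w.1))
   then D a (a + (block_sum (tk bi + 1) w.1 + block_sum (tk bi + 2) w.2))
          (src (bi, a)).2 * pair_weight w else 0).
rewrite lee_fin [leLHS](_ : _ = \sum_bi \sum_a body bi a); last first.
  rewrite [RHS]pair_bigA; apply: eq_bigr => -[bi a] _; apply: eq_bigr => w _.
  rewrite /body /= path_tgt_kinds srcdiv -/(tk bi) /=.
  rewrite asboolb /path_edges /= mem_kinds srcdiv -/k -/o -!/(G _) /=.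
  congr (if _ then _ else _); rewrite /tk; case: bi => -[] i /=.
    rewrite (_ : k - 2 + 1 = k - 1) ?subrK ?eqxx ?addrA; last by lia.
    by rewrite (_ : (k - 1 == k) = false) //; lia.
  rewrite (_ : (k - 1 + 2 == k) = false) ?orbF ?subrK ?eqxx //; lia.
have bodyle bi : \sum_a body bi a <= wt * (cnt%:R * (K%:R * r)).
  case: bi => -[] i; rewrite /body /tk /=.
    rewrite (_ : k - 2 + 1 = k - 1); last by lia.
    apply: (@load_phase2 r (fun a b => D a b ((k - 2) * P%:Z + (i : nat)%:Z))) => //.
  apply: (@load_phase1 r (fun a b => D a b ((k - 1) * P%:Z + (i : nat)%:Z))) => //.
apply: le_trans (ler_sum _ (fun bi _ => bodyle bi)) _.
rewrite sumr_const card_prod card_bool card_ord -[leLHS]mulr_natl.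
have := load o (modP_lt u); rewrite -/cnt !natrM => le1.
have KN : 0 < K%:R ^+ 2 * N%:R :> R.
  by rewrite mulr_gt0 ?exprn_gt0 ?ltr0n //; lia.
rewrite mulrCA [wt * _]mulrC. rewrite ler_pdivrMr // mul1r.
have := ler_wpM2l (ler0n R K) le1; lra.
Qed.

End Routing.

Lemma modn_mul_digits x a b :
  (x %% (a * b) = x %% a + (x %/ a %% b) * a)%N.
Proof.
have h1 := divn_eq x (a * b); have h2 := divn_eq x a.
move: h1 h2 (divn_eq (x %/ a) b); rewrite divnMA.
move: (x %/ a)%N (x %% a)%N (x %% (a * b))%N => q r t.
move: (q %/ b)%N (q %% b)%N => c d h1 h2 h3; subst q.
by apply: (@addnI (c * (a * b))); rewrite -h1 h2; ring.
Qed.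

(** * Digit rotations *)

Section Rotation.
Variables (m L : nat).
Hypothesis m_gt0 : (0 < m)%N.
Local Open Scope nat_scope.

(** For [x < m ^ L], the cyclic rotation of [L] base-[m] digits: the top [q] digits become the
    lowest. *)
Definition rot_digits (q x : nat) : nat :=
  m ^ q * (x %% m ^ (L - q)) + x %/ m ^ (L - q).

Lemma rot_digits0 x : x < m ^ L -> rot_digits 0 x = x.
Proof.
by move=> xM; rewrite /rot_digits subn0 mul1n modn_small // divn_small // addn0.
Qed.

Lemma rot_digits_lt q x : q <= L -> x < m ^ L -> rot_digits q x < m ^ L.
Proof.
move=> qL xM; rewrite /rot_digits.
have e : m ^ L = m ^ q * m ^ (L - q) by rewrite -expnD subnKC.
have p1 : 0 < m ^ q by rewrite expn_gt0 m_gt0.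
have p2 : 0 < m ^ (L - q) by rewrite expn_gt0 m_gt0.
have h1 : x %/ m ^ (L - q) < m ^ q by rewrite ltn_divLR // -e.
have h2 := ltn_pmod x p2; rewrite e; nia.
Qed.

(** Lets the programs obtain all rotations by moving one digit at a time. *)
Lemma rot_digitsS q x : q < L -> x < m ^ L ->
  rot_digits q.+1 x = rot_digits 1 (rot_digits q x).
Proof.
move=> qL xM; set e := L - q.+1.
have Lq : L - q = e.+1 by rewrite /e; lia.
have L1 : L - 1 = q + e by rewrite /e; lia.
have p1 : 0 < m ^ e by rewrite expn_gt0 m_gt0.
rewrite /rot_digits Lq -/e L1 expn1.
(* [x] is split into its top [q] digits [a], the next digit [b1] and the low [e] digits [b0]. *)
set a := x %/ m ^ e.+1.
have aE : a = x %/ m ^ e %/ m by rewrite -divnMA -expnSr.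
have b0lt := ltn_pmod x p1.
have alt : a < m ^ q.
  by rewrite ltn_divLR ?expn_gt0 ?m_gt0 // -expnD addnS -addSn subnKC.
have -> : x %% m ^ e.+1 = (x %/ m ^ e %% m) * m ^ e + x %% m ^ e.
  by rewrite expnSr modn_mul_digits addnC.
set b1 := _ %% m; set b0 := x %% _.
have -> : m ^ q * (b1 * m ^ e + b0) + a = b1 * m ^ (q + e) + (m ^ q * b0 + a).
  by rewrite expnD; ring.
have lt : m ^ q * b0 + a < m ^ (q + e).
  by rewrite expnD; move: b0lt; rewrite -/b0; nia.
rewrite modnMDl modn_small // divnMDl ?expn_gt0 ?m_gt0 // (divn_small lt).
by rewrite (divn_eq (x %/ m ^ e) m) -/b1 -aE expnS; ring.
Qed.

Lemma rot_digitsK r y : r <= L -> y < m ^ L ->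
  rot_digits r (rot_digits (L - r) y) = y.
Proof.
move=> rL yM; rewrite /rot_digits subKn // mulnC.
have lt : y %/ m ^ r < m ^ (L - r).
  by rewrite ltn_divLR ?expn_gt0 ?m_gt0 // -expnD subnK.
rewrite mulnC [m ^ (L - r) * _]mulnC modnMDl modn_small //.
rewrite divnMDl ?expn_gt0 ?m_gt0 // [_ %/ m ^ (L - r)]divn_small // addn0.
by rewrite mulnC -divn_eq.
Qed.

(** Both sides cut [k] at digit position [L - (r + e)], so [k] may be arbitrary. *)
Lemma rot_digitsM r e k : r + e <= L ->
  rot_digits r (k * m ^ e) = rot_digits (r + e) k.
Proof.
move=> reL; rewrite /rot_digits.
rewrite (_ : L - r = (L - (r + e)) + e); last by lia.
rewrite expnD -muln_modl divnMr ?expn_gt0 ?m_gt0 //.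
by rewrite expnD; ring.
Qed.

(* The summands occupy disjoint digit positions, so the rotation acts on them
   without carries. *)
Lemma rot_digitsD r e x k : r <= L -> x < m ^ e ->
  rot_digits r (x + k * m ^ e) = rot_digits r x + rot_digits r (k * m ^ e).
Proof.
move=> rL xe; rewrite /rot_digits; set d := L - r.
have pd : 0 < m ^ d by rewrite expn_gt0 m_gt0.
suff [-> ->] : (x + k * m ^ e) %% m ^ d = x %% m ^ d + (k * m ^ e) %% m ^ d /\
               (x + k * m ^ e) %/ m ^ d = x %/ m ^ d + (k * m ^ e) %/ m ^ d.
  by ring.
have [ed|de] := leqP e d; last first.
  have dv : m ^ d %| k * m ^ e by rewrite dvdn_mull // dvdn_exp2l // ltnW.
  split; last by rewrite divnDr.
  by rewrite (eqP dv) addn0 -modnDmr (eqP dv) addn0.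
have de : m ^ d = m ^ (d - e) * m ^ e by rewrite -expnD subnK.
have xd : x < m ^ d by apply: leq_trans xe _; rewrite leq_pexp2l.
have lt : x + k * m ^ e %% m ^ d < m ^ d.
  rewrite de -muln_modl.
  have pp : 0 < m ^ (d - e) by rewrite expn_gt0 m_gt0.
  have := ltn_pmod k pp; nia.
rewrite (modn_small xd) (divn_small xd) add0n {1 3}(divn_eq (k * m ^ e) (m ^ d)).
rewrite addnCA modnMDl modn_small //; split=> //.
by rewrite divnMDl // (divn_small lt) addn0.
Qed.

Variables (g h : nat).
Hypotheses (Lgh : L = g * h) (g_gt0 : 0 < g).

(** Rotating the [g]-digit block [i b] by [r + b * g] amounts to placing it at position [g * b] and
    rotating by [r]. The placed blocks do not overlap, so the rotations add up to that of the
    concatenation. *)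
Lemma sum_rot_digits r n (i : nat -> nat) : r < g -> n <= h ->
  (forall b, b < n -> i b < m ^ g) ->
  \sum_(b < n) i b * m ^ (g * b) < m ^ (g * n) /\
  \sum_(b < n) rot_digits (r + b * g) (i b) =
  rot_digits r (\sum_(b < n) i b * m ^ (g * b)).
Proof.
move=> rg; elim: n => [|n IH] nh ilt.
  by rewrite !big_ord0 muln0 /rot_digits mod0n div0n muln0.
have [|b bn|lt IHn] := IH; [exact: ltnW | by apply: ilt; rewrite ltnS ltnW |].
rewrite !big_ord_recr /=; split.
  rewrite mulnSr expnD [leqRHS]mulnC.
  by apply: leq_trans (leq_mul (ilt n (ltnSn n)) (leqnn _)); rewrite mulSn ltn_add2r.
have gnL : g + g * n <= L by rewrite Lgh -mulnS leq_mul.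
rewrite rot_digitsD // ?IHn ?rot_digitsM; [by rewrite [g * n]mulnC | lia | lia].
Qed.

Lemma sum_digits n z :
  \sum_(b < n) (z %/ m ^ (g * b) %% m ^ g) * m ^ (g * b) = z %% m ^ (g * n).
Proof.
elim: n => [|n IH]; first by rewrite big_ord0 muln0 modn1.
rewrite big_ord_recr /= IH mulnSr expnD.
by rewrite modn_mul_digits.
Qed.

Definition digit_vec := {ffun 'I_h -> 'I_(m ^ g)}.

Definition rot_sum (r : nat) (i : digit_vec) : nat :=
  \sum_(b < h) rot_digits (r + b * g) (i b).

Lemma rot_sumE r (i : digit_vec) : r < g ->
  \sum_(b < h) i b * m ^ (g * b) < m ^ L /\
  rot_sum r i = rot_digits r (\sum_(b < h) i b * m ^ (g * b)).
Proof.
(* Extends [i] to all naturals; the default 0 is never read, since only [b < h] occurs. *)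
move=> rg; pose i' b := oapp (fun c => i c : nat) 0 (insub b).
have i'E (b : 'I_h) : i' b = i b by rewrite /i' valK.
have [|b bh|lt e] := @sum_rot_digits r h i' rg; [exact: leqnn | |].
  by rewrite (i'E (Ordinal bh)).
have eS : \sum_(b < h) i' b * m ^ (g * b) = \sum_(b < h) i b * m ^ (g * b).
  by apply: eq_bigr => b _; rewrite i'E.
rewrite eS in lt e; split; first by rewrite Lgh.
by rewrite -e; apply: eq_bigr => b _; rewrite i'E.
Qed.

Lemma rot_sum_lt r (i : digit_vec) : r < g -> 0 < h -> rot_sum r i < m ^ L.
Proof.
move=> rg h_gt0; have [lt ->] := rot_sumE i rg.
by apply: rot_digits_lt => //; rewrite Lgh (leq_trans (ltnW rg)) ?leq_pmulr.
Qed.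

(** The digit vector is read off by rotating [y] back and cutting it into [h] blocks of [g] digits.
    This map [psi] is injective between sets of equal size, so its left inverse [phi] is
    two-sided. *)
Lemma rot_sum_unique (r y : nat) : 0 < h -> r < g -> y < m ^ L ->
  #|[pred i | rot_sum r i == y]| = 1.
Proof.
move=> h_gt0 rg yM.
have W0 : 0 < m ^ g by rewrite expn_gt0 m_gt0.
have rL : r <= L by rewrite Lgh (leq_trans (ltnW rg)) ?leq_pmulr.
pose phi i := Ordinal (rot_sum_lt i rg h_gt0).
pose psi (z : 'I_(m ^ L)) : digit_vec :=
  [ffun b : 'I_h => Ordinal (ltn_pmod (rot_digits (L - r) z %/ m ^ (g * b)) W0)].
have psiK : cancel psi phi.
  move=> z; apply: val_inj => /=; have [_ ->] := rot_sumE (psi z) rg.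
  under eq_bigr do rewrite ffunE /=.
  rewrite sum_digits -Lgh modn_small ?rot_digitsK //.
  by rewrite rot_digits_lt ?leq_subr.
have psi_bij : bijective psi.
  apply: inj_card_bij (can_inj psiK) _.
  by rewrite card_ffun !card_ord -expnM -Lgh.
have phiK : cancel phi psi by apply/(bij_can_sym psi_bij).
rewrite (@eq_card _ _ (pred1 (psi (Ordinal yM)))) ?card1 // => i.
rewrite !inE; apply/eqP/eqP => [e|->].
  by apply: (can_inj phiK); rewrite psiK; apply: val_inj.
exact: (congr1 val (psiK (Ordinal yM))).
Qed.

End Rotation.

(** * Auxiliary finite sums and counts *)

Lemma sum_over_image (V : nmodType) (P h : nat) (phi : 'I_h -> 'I_P)
    (F : nat -> V) : injective phi ->
  \sum_(j < P) (if [exists b, val j == phi b :> nat] then F j else 0) =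
  \sum_b F (phi b).
Proof.
move=> phi_inj; rewrite -big_mkcond /=.
rewrite (eq_bigl (mem (codom phi))); last first.
  move=> j; apply/existsP/codomP => [[b /eqP e]|[b ->]]; last by exists b.
  by exists b; apply: val_inj.
rewrite -big_uniq /=; last by rewrite map_inj_uniq ?enum_uniq.
by rewrite big_map big_enum.
Qed.

Lemma card_ffun_fixed_value (h W : nat) (b : 'I_h) (c : 'I_W) :
  #|[pred i : {ffun 'I_h -> 'I_W} | i b == c]| = (W ^ h.-1)%N.
Proof.
rewrite (@eq_card _ _ (mem (family (fun b' : 'I_h =>
  if b' == b then pred1 c else predT)))) => [|i]; last first.
  rewrite !inE; apply/eqP/familyP => [e b'|/(_ b)]; last by rewrite eqxx => /eqP.
  by case: eqP => [->|]; rewrite ?inE ?e.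
rewrite card_family foldrE big_map big_enum (bigD1 b) //= eqxx card1 mul1n.
rewrite (eq_bigr (fun=> W)) => [|b' /negbTE ->]; last by rewrite card_ord.
by rewrite prod_nat_const cardC1 card_ord.
Qed.

(** * The rotation schedule and its routing protocol *)

Definition rotation_shift (m L t : nat) : nat :=
  rot_digits m L (t %% L)%N (t %/ L)%N.

Definition rotation_schedule (N m L : nat) : seq 'Z_N :=
  mkseq (fun t => (rotation_shift m L t)%:R) (L * m ^ L)%N.

Section RotationRouting.
Variables (R : realType) (N m g h : nat).
Hypotheses (N_gt1 : (1 < N)%N) (m_gt0 : (0 < m)%N).
Hypotheses (g_gt0 : (0 < g)%N) (h_gt0 : (0 < h)%N).
Let L := (g * h)%N.
Let W := (m ^ g)%N.
Let P := (L * W)%N.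
Hypothesis N_le : (N <= m ^ L)%N.
Notation s := (rotation_schedule N m L).

Let Om : finType := ('I_g * digit_vec m g h)%type.

(** Hop [b] uses direction [w.1 + b * g], at the time whose low [g] digits of tau are [w.2 b]. *)
Let slot (w : Om) (b : 'I_h) : nat := (w.2 b * L + (w.1 + b * g))%N.

Let admissible : {pred Om} := [pred w : Om | rot_sum L w.1 w.2 < N]%N.

Let selected (w : Om) (o : nat) : bool := [exists b : 'I_h, o == slot w b].

Let dir_lt (w : Om) (b : 'I_h) : (w.1 + b * g < L)%N.
Proof.
have h1 := ltn_ord w.1; have h2 : (b.+1 * g <= h * g)%N by rewrite leq_mul.
by rewrite /L [(g * h)%N]mulnC; apply: leq_trans h2; rewrite mulSn ltn_add2r.
Qed.

Let slot_divn w b : (slot w b %/ L)%N = w.2 b.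
Proof. by rewrite divnMDl ?divn_small ?addn0 ?dir_lt // muln_gt0 g_gt0. Qed.

Let slot_modn w b : (slot w b %% L)%N = (w.1 + b * g)%N.
Proof. by rewrite modnMDl modn_small ?dir_lt. Qed.

Let slot_phase w b : (slot w b %% L %% g)%N = w.1.
Proof. by rewrite slot_modn addnC modnMDl modn_small. Qed.

Let slot_index w b : (slot w b %% L %/ g)%N = b.
Proof. by rewrite slot_modn addnC divnMDl // divn_small ?addn0. Qed.

Let slot_lt w b : (slot w b < P)%N.
Proof.
have h1 := dir_lt w b; have h2 : ((w.2 b).+1 * L <= W * L)%N by rewrite leq_mul.
by rewrite /P [(L * W)%N]mulnC; apply: leq_trans h2; rewrite /slot mulSn addnC ltn_add2r.
Qed.

Let L_gt0 : (0 < L)%N. Proof. by rewrite muln_gt0 g_gt0. Qed.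
Let W_gt0 : (0 < W)%N. Proof. by rewrite expn_gt0 m_gt0. Qed.
Let P_gt0 : (0 < P)%N. Proof. by rewrite muln_gt0 L_gt0. Qed.
Let le_gL : (g <= L)%N. Proof. by rewrite leq_pmulr. Qed.

Let period_E : (L * m ^ L = m ^ (L - g) * P)%N.
Proof. by rewrite /P mulnCA -expnD subnK. Qed.

Let size_s : size s = (m ^ (L - g) * P)%N.
Proof. by rewrite size_mkseq period_E. Qed.

Let size_s_gt0 : (0 < size s)%N.
Proof. by rewrite size_s muln_gt0 P_gt0 expn_gt0 m_gt0. Qed.

(** A period consists of [m ^ (L - g)] windows, so [kk] holds the high digits of tau, constant on
    the window. *)
Let shift_at_slot (k : int) w b (kk := absz (k %% (m ^ (L - g))%N%:Z)%Z) :
  shift_at s (k * P%:Z + (slot w b)%:Z) =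
  (rot_digits m L (w.1 + b * g) (kk * W + w.2 b))%:R.
Proof.
set Q := (m ^ (L - g))%N in kk *.
have Q0 : (0 < Q)%N by rewrite expn_gt0 m_gt0.
have QQ : Q%:Z != 0 by lia.
have kkE : kk%:Z = (k %% Q%:Z)%Z by rewrite gez0_abs ?modz_ge0.
have kkQ : (kk < Q)%N by rewrite -ltz_nat kkE ltz_pmod.
have lt : (kk * P + slot w b < Q * P)%N.
  have h1 := slot_lt w b; have h2 : (kk.+1 * P <= Q * P)%N by rewrite leq_mul.
  by apply: leq_trans h2; rewrite mulSn addnC ltn_add2r.
rewrite /shift_at size_s -/Q.
rewrite (_ : absz _ = kk * P + slot w b)%N; last first.
  have -> : k * P%:Z + (slot w b)%:Z =
            (k %/ Q%:Z)%Z * (Q * P)%N%:Z + (kk * P + slot w b)%N%:Z.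
    by rewrite {1}(divz_eq k Q%:Z) -kkE !PoszM !PoszD !PoszM; ring.
  by rewrite modzMDl modz_small // lez_nat leq0n ltz_nat.
rewrite nth_mkseq; last by rewrite period_E.
rewrite /rotation_shift (_ : kk * P + slot w b = kk * W * L + slot w b)%N; last first.
  by rewrite /P; ring.
by rewrite modnMDl divnMDl // slot_modn slot_divn.
Qed.

(** Rotation adds over the high and low digits of tau; the high part is a translate that depends
    only on the window and on [w.1]. *)
Let block_sum_rot (k : int) (w : Om) (kk := absz (k %% (m ^ (L - g))%N%:Z)%Z) :
  block_sum s P selected k w =
  (\sum_(b < h) rot_digits m L (w.1 + b * g) (kk * W))%:R + (rot_sum L w.1 w.2)%:R.
Proof.
pose phi b := Ordinal (slot_lt w b).
have phi_inj : injective phi.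
  move=> b b' /(congr1 val) /= e; apply: val_inj.
  by rewrite /= -(slot_index w b) e slot_index.
rewrite /block_sum disp_sum size_block.
pose F o := shift_at s (k * P%:Z + (o : nat)%:Z).
transitivity (\sum_(j < P) (if [exists b, val j == phi b :> nat] then F j else 0)).
  by apply: eq_bigr => j _; rewrite nth_mkseq.
rewrite sum_over_image // /rot_sum !natr_sum -big_split /=; apply: eq_bigr => b _.
rewrite /F shift_at_slot -natrD -/kk [(kk * W + _)%N]addnC.
by rewrite rot_digitsD ?(ltnW (dir_lt _ _)) // [(rot_digits _ _ _ (w.2 b) + _)%N]addnC.
Qed.

(** Each of the [g] values of [w.1] contributes one choice: after removal of its translate the
    target is a number below [N], reached by a unique digit vector, which is admissible. *)
Let block_sum_count k z :
  #|[pred w in admissible | block_sum s P selected k w == z]| = g.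
Proof.
set c := fun r => (\sum_(b < h) rot_digits m L (r + b * g)
   (absz (k %% (m ^ (L - g))%N%:Z)%Z * W))%:R : 'Z_N.
rewrite -sum1_card big_mkcond /=.
rewrite -(pair_bigA _ (fun r i => if ((r, i) : Om) \in
  [pred w in admissible | block_sum s P selected k w == z] then 1 else 0)%N) /=.
rewrite (eq_bigr (fun=> 1%N)) => [|r _]; first by rewrite sum1_card card_ord.
have [y yE yN] : exists2 y : 'Z_N, y = z - c r & (y < N)%N.
  by exists (z - c r); rewrite // -[ltnRHS](Zp_cast N_gt1).
rewrite -big_mkcond sum1_card -[RHS](@rot_sum_unique m L m_gt0 g h erefl g_gt0 r
  y) //; last by apply: leq_trans yN N_le.
apply: eq_card => i; rewrite [LHS]unfold_in !inE /= block_sum_rot -/(c r).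
rewrite addrC eq_sym -subr_eq -yE.
apply/andP/eqP => [[lt /eqP ->]|e].
  by rewrite val_Zp_nat // modn_small.
by rewrite e natr_Zp eqxx; split.
Qed.

(** A slot determines [w.1], the hop that uses it and that hop's entry; the other [h - 1] entries
    remain free. *)
Let selected_count o : (o < P)%N ->
  (#|[pred w in admissible | selected w o]| <= W ^ h.-1)%N.
Proof.
move=> oP.
have [w0 /andP[_ /existsP[b0 /eqP o0]]|none] :=
    pickP [pred w in admissible | selected w o]; last by rewrite eq_card0.
rewrite -(card_ffun_fixed_value b0 (w0.2 b0)).
rewrite -(card_imset _ (f := fun i => (w0.1, i) : Om)); last by move=> i j [].
apply/subset_leq_card/fintype.subsetP => w /andP[_ /existsP[b /eqP ob]].
have eb : b = b0 by apply: val_inj; rewrite /= -(slot_index w b) -ob o0 slot_index.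
have er : w.1 = w0.1 by apply: val_inj; rewrite /= -(slot_phase w b) -ob o0 slot_phase.
have ei : w.2 b0 = w0.2 b0.
  by apply: val_inj; rewrite /= -(slot_divn w0 b0) -o0 ob eb slot_divn.
by apply/imsetP; exists w.2; rewrite ?inE ?ei // -er; case: (w).
Qed.

(** With [K = g], a slot satisfies [P * cnt <= L * m ^ L]; multiplied by [(1 - eps) / h] this
    becomes [g * (1 - eps) * m ^ L], at most [g * N]. *)
Lemma rotation_routing (eps : R) : (1 - eps) * (m ^ L)%:R <= N%:R ->
  exists f : dipath 'Z_N -> R,
    [/\ oblivious_routing_protocol (shift_schedule s) f,
        guarantees_throughput (shift_schedule s) f (1 / (2 * h%:R) * (1 - eps)) &
        max_latency_le (shift_schedule s) f (3 * P)%:R].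
Proof.
move=> Meps.
have P_dvd : (P %| size s)%N by rewrite size_s dvdn_mull.
exists (vlb R P admissible selected g); split.
- exact: vlb_protocol.
- apply: vlb_throughput => // o oP.
  have := selected_count oP; set cnt := #|_| => le1.
  have le2 : (P * cnt <= L * m ^ L)%N.
    rewrite /P -mulnA leq_mul2l; apply/orP; right.
    rewrite [in leqRHS]/L expnM -/W -[in leqRHS](prednK h_gt0) expnS.
    by rewrite leq_mul2l le1 orbT.
  have hR : h%:R != 0 :> R by rewrite pnatr_eq0; lia.
  (* For [eps > 1] the claimed throughput is negative and the load bound is trivial. *)
  have [e1|/ltW e1] := lerP 0 (1 - eps); last first.
    apply: le_trans (ler0n _ _); rewrite mulr_ge0_le0 ?mulr_ge0 //.
    by rewrite mulr_ge0_le0 // divr_ge0 // mulr_ge0.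
  rewrite (_ : 2 * _ * _ = (P * cnt)%:R * ((1 - eps) / h%:R)); last by field.
  apply: (@le_trans _ _ ((L * m ^ L)%:R * ((1 - eps) / h%:R))).
    by rewrite ler_wpM2r ?divr_ge0 // ler_nat.
  rewrite (_ : _ * _ = g%:R * ((1 - eps) * (m ^ L)%:R)).
    by rewrite natrM ler_wpM2l.
  by rewrite /L !natrM; field.
- exact: vlb_latency.
Qed.

End RotationRouting.

(** * Programs *)

Section Programs.
Local Open Scope nat_scope.

(** Makes the certifier's verdict unique, so that one constructed run settles acceptance. *)
Lemma exec_det c st t1 st1 t2 st2 :
  exec c st t1 st1 -> exec c st t2 st2 -> t1 = t2 /\ st1 = st2.
Proof.
move=> e; elim: e t2 st2 => {c st t1 st1}; intros;
  match goal with H : exec _ _ ?t ?st |- _ = ?t /\ _ = ?st =>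
    inversion H; clear H end; subst => //;
  try by match goal with
  | H : is_true (?x != 0), H' : ?x = 0 |- _ => rewrite H' in H end.
all: repeat match goal with
  | IH : (forall t2 st2, exec ?c ?s t2 st2 -> _), H : exec ?c ?s _ _ |- _ =>
    destruct (IH _ _ H); clear IH; subst end => //.
Qed.

(** An upper bound on the steps, so that iterations of different cost share one bound. *)
Definition runs (c : prog) (st : state) (n : nat) (st' : state) : Prop :=
  exists2 t, t <= n & exec c st t st'.

Lemma runs_le c st n n' st' : runs c st n st' -> n <= n' -> runs c st n' st'.
Proof. by move=> [t tn e] nn; exists t => //; apply: leq_trans nn. Qed.

Lemma runs_conv c st n n' st1 st2 :
  runs c st n st1 -> st1 = st2 -> n <= n' -> runs c st n' st2.
Proof. by move=> r <-; apply: runs_le. Qed.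

Lemma runs_seq c1 c2 st1 st2 st3 n1 n2 :
  runs c1 st1 n1 st2 -> runs c2 st2 n2 st3 ->
  runs (PSeq c1 c2) st1 (n1 + n2) st3.
Proof.
move=> [t1 l1 e1] [t2 l2 e2]; exists (t1 + t2); first exact: leq_add.
exact: ExSeq e1 e2.
Qed.

Lemma runs_while e c (F : nat -> state) n b :
  (forall i, i < n -> Defs.eval (F i) e != 0) -> Defs.eval (F n) e = 0 ->
  (forall i, i < n -> runs c (F i) b (F i.+1)) ->
  runs (PWhile e c) (F 0) (n * b.+1 + 1) (F n).
Proof.
move=> guard stop body.
suff H k : k <= n -> runs (PWhile e c) (F (n - k)) (k * b.+1 + 1) (F n).
  by have := H n (leqnn n); rewrite subnn.
elim: k => [|k IH] kn; first by rewrite subn0; exists 1 => //; exact: ExWhileF.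
have lt : n - k.+1 < n by lia.
have [t1 l1 e1] := body _ lt; have [t2 l2 e2] := IH (ltnW kn).
exists (t1 + t2).+1; first by rewrite mulSn; lia.
apply: ExWhileT (guard _ lt) e1 _.
by rewrite (_ : (n - k.+1).+1 = n - k) //; lia.
Qed.

Fixpoint repeat_prog (n : nat) (c : prog) : prog :=
  if n is n'.+1 then PSeq c (repeat_prog n' c) else PSkip.

Lemma runs_repeat c (F : nat -> state) n b :
  (forall i, i < n -> runs c (F i) b (F i.+1)) ->
  runs (repeat_prog n c) (F 0) (n * b + 1) (F n).
Proof.
elim: n F => [|n IH] F body; first by exists 1 => //; exact: ExSkip.
rewrite mulSn -addnA; apply: runs_seq (body 0 isT) _.
by apply: (IH (fun i => F i.+1)) => i lt; apply: body.
Qed.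

(** With the registers kept in a list, simplification computes the effect of an assignment. *)
Definition bank (l : seq nat) (hp : nat -> nat) (w : seq bool) : state :=
  State (fun x => nth 0 l x) hp w.

Lemma runs_set l hp w x e :
  runs (PSet x e) (bank l hp w) 1
       (bank (set_nth 0 l x (Defs.eval (bank l hp w) e)) hp w).
Proof.
exists 1 => //; rewrite /bank.
have -> : (fun y => nth 0 (set_nth 0 l x (Defs.eval (bank l hp w) e)) y) =
    upd (fun y => nth 0 l y) x (Defs.eval (bank l hp w) e).
  by apply/funext => y; rewrite nth_set_nth.
exact: ExSet.
Qed.

Lemma runs_skip st : runs PSkip st 1 st.
Proof. by exists 1 => //; exact: ExSkip. Qed.

Ltac run_set := eapply runs_seq; [exact: runs_set | rewrite /=].

(* Registers: 0 holds N, 1 the input length, 2 the base m, 3 the number M = m^L,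
   4 the counter tau, 5 the slot, 6 the rotated digits, 7 and 8 are scratch, and
   9 is set by the certifier on a mismatch. *)

Definition mul_prog (src : nat) : prog :=
  PSeq (PSet 8 (EReg 2))
       (PWhile (EReg 8) (PSeq (PSet 7 (EAdd (EReg 7) (EReg src)))
                              (PSet 8 (ESub (EReg 8) (ECst 1))))).

Definition pow_prog (L : nat) : prog :=
  PSeq (PSet 3 (ECst 1))
    (repeat_prog L
      (PSeq (mul_prog 3) (PSeq (PSet 3 (EReg 7)) (PSet 7 (ECst 0))))).

(** Truncated subtraction acts as a comparison: the guard is nonzero exactly while [M < N]. *)
Definition root_prog (L : nat) : prog :=
  PWhile (ESub (EReg 0) (EReg 3))
    (PSeq (PSet 2 (EAdd (EReg 2) (ECst 1))) (pow_prog L)).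

(** [act] finds the slot in register 5 and the reduced shift in register 7; afterwards register 6 is
    rotated by one more place. *)
Definition step_prog (act : prog) : prog :=
  PSeq (PSet 7 (EReg 6))
 (PSeq (PWhile (ESub (EAdd (EReg 7) (ECst 1)) (EReg 0))
          (PSet 7 (ESub (EReg 7) (EReg 0))))
 (PSeq act
 (PSeq (PSet 5 (EAdd (EReg 5) (ECst 1)))
 (PSeq (PSet 7 (ECst 0))
 (PSeq (mul_prog 6)
 (PSeq (PWhile (ESub (EAdd (EReg 7) (ECst 1)) (EReg 3))
          (PSet 7 (ESub (EAdd (EReg 7) (ECst 1)) (EReg 3))))
 (PSeq (PSet 6 (EReg 7)) (PSet 7 (ECst 0))))))))).

Definition main_prog (L : nat) (act : prog) : prog :=
  PSeq (root_prog L)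
    (PWhile (ESub (EReg 3) (EReg 4))
      (PSeq (PSet 6 (EReg 4))
      (PSeq (repeat_prog L (step_prog act))
      (PSeq (PSet 6 (ECst 0)) (PSet 4 (EAdd (EReg 4) (ECst 1))))))).

(** * Correctness and cost of the arithmetic routines *)

Section Runs.
Variables (w : seq bool) (N : nat).

Lemma runs_mul src a m M t i x fl hp : src < 7 ->
  runs (mul_prog src) (bank [:: N; a; m; M; t; i; x; 0; 0; fl] hp w) (m * 3 + 2)
    (bank [:: N; a; m; M; t; i; x; m * nth 0 [:: N; a; m; M; t; i; x] src; 0; fl]
       hp w).
Proof.
move=> src_lt.
(* The loop changes only registers 7 and 8, so every pass reads the same factor. *)
have vE y c : nth 0 [:: N; a; m; M; t; i; x; y; c; fl] src =
    nth 0 [:: N; a; m; M; t; i; x] src.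
  by move: src_lt; case: src => [|[|[|[|[|[|[|]]]]]]].
set v := nth _ _ _ in vE *.
pose F j := bank [:: N; a; m; M; t; i; x; j * v; m - j; fl] hp w.
eapply runs_conv.
- run_set; rewrite (_ : bank _ _ _ = F 0); last by rewrite /F subn0.
  apply: (@runs_while _ _ F m 2).
  + by move=> j jm; rewrite /= -lt0n subn_gt0.
  + by rewrite /= subnn.
  + move=> j jm; eapply runs_conv; [run_set; exact: runs_set | | by []].
    by rewrite /F /= vE mulSnr subn1 subnS.
- by rewrite /F subnn.
- lia.
Qed.

Lemma runs_pow L a m M hp0 :
  runs (pow_prog L) (bank [:: N; a; m; M; 0; 0; 0; 0; 0; 0] hp0 w)
    (L * (m * 3 + 4) + 2) (bank [:: N; a; m; m ^ L; 0; 0; 0; 0; 0; 0] hp0 w).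
Proof.
pose F j := bank [:: N; a; m; m ^ j; 0; 0; 0; 0; 0; 0] hp0 w.
eapply runs_conv; [run_set; apply: (@runs_repeat _ F L (m * 3 + 4)) | by [] | lia].
move=> j _; rewrite /F; eapply runs_conv.
- eapply runs_seq; first exact: (@runs_mul 3).
  by run_set; exact: runs_set.
- by rewrite /= expnS.
- lia.
Qed.

Lemma runs_root L a m hp0 : 0 < L -> N <= m ^ L ->
  (forall j, j < m -> j ^ L < N) ->
  runs (root_prog L) (bank [:: N; a; 0; 0; 0; 0; 0; 0; 0; 0] hp0 w)
    (m * (L * (m * 3 + 4) + 4) + 1)
    (bank [:: N; a; m; m ^ L; 0; 0; 0; 0; 0; 0] hp0 w).
Proof.
move=> L_gt0 NmL mlt.
pose F j := bank [:: N; a; j; j ^ L; 0; 0; 0; 0; 0; 0] hp0 w.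
rewrite (_ : bank [:: N; a; 0; 0; 0; 0; 0; 0; 0; 0] hp0 w = F 0); last first.
  by rewrite /F exp0n.
eapply runs_conv;
  [apply: (@runs_while _ _ F m (L * (m * 3 + 4) + 3)) | by [] | lia].
- by move=> j jm; rewrite /= -lt0n subn_gt0 mlt.
- by rewrite /=; apply/eqP.
- move=> j jm; rewrite /F; eapply runs_conv; first by run_set; exact: runs_pow.
    by rewrite /= addn1.
  have : L * (j.+1 * 3 + 4) <= L * (m * 3 + 4) by rewrite leq_mul2l; lia.
  by rewrite addn1; lia.
Qed.

(** * The loop over all slots of the period *)

Section Main.
Variables (m L a ba : nat) (act : prog) (fl : nat -> nat) (hp : nat -> nat -> nat).
Hypotheses (L_gt0 : 0 < L) (N_gt0 : 0 < N) (m_gt0 : 0 < m).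
Let M := m ^ L.
(** [hp i] and [fl i] are the heap and register 9 just before slot [i]; storing and comparing are
    both instances. *)
Hypothesis runs_act : forall t i x, i < L * M ->
  runs act
    (bank [:: N; a; m; M; t; i; x; rotation_shift m L i %% N; 0; fl i] (hp i) w) ba
    (bank [:: N; a; m; M; t; i; x; rotation_shift m L i %% N; 0; fl i.+1]
       (hp i.+1) w).

(** Adding 1 in the guard makes it nonzero exactly while the remainder is at least [N]. *)
Let runs_mod t i x :
  runs (PWhile (ESub (EAdd (EReg 7) (ECst 1)) (EReg 0))
          (PSet 7 (ESub (EReg 7) (EReg 0))))
    (bank [:: N; a; m; M; t; i; x; x; 0; fl i] (hp i) w) (x * 2 + 1)
    (bank [:: N; a; m; M; t; i; x; x %% N; 0; fl i] (hp i) w).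
Proof.
pose F j := bank [:: N; a; m; M; t; i; x; x - j * N; 0; fl i] (hp i) w.
rewrite (_ : bank [:: N; a; m; M; t; i; x; x; 0; fl i] (hp i) w = F 0); last first.
  by rewrite /F mul0n subn0.
have xE := divn_eq x N; have xN := ltn_pmod x N_gt0.
eapply runs_conv; [apply: (@runs_while _ _ F (x %/ N) 1) | |].
- move=> j jm; rewrite /= -lt0n subn_gt0.
  have : j.+1 * N <= x %/ N * N by rewrite leq_mul2r jm orbT.
  by rewrite mulSn; lia.
- by rewrite /=; apply/eqP; rewrite subn_eq0; lia.
- move=> j jm; eapply runs_conv; [exact: runs_set | | by []].
  by rewrite /=/F mulSnr subnDA.
- by rewrite /F {2}xE addKn.
- by rewrite leq_add2r leq_mul2r leq_div.
Qed.

(* One step of the loop subtracts M - 1, which moves the overflowing digit of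
   m x from position L to position 0. *)
Let runs_wrap t i x : x < M ->
  runs (PWhile (ESub (EAdd (EReg 7) (ECst 1)) (EReg 3))
          (PSet 7 (ESub (EAdd (EReg 7) (ECst 1)) (EReg 3))))
    (bank [:: N; a; m; M; t; i; x; m * x; 0; fl i] (hp i) w) (M * 2 + 1)
    (bank [:: N; a; m; M; t; i; x; rot_digits m L 1 x; 0; fl i] (hp i) w).
Proof.
move=> xM; set e := m ^ (L - 1).
have eM : M = m * e by rewrite /M /e -expnS; congr (_ ^ _); lia.
have e_gt0 : 0 < e by rewrite expn_gt0 m_gt0.
have xE := divn_eq x e; have xe := ltn_pmod x e_gt0.
have lt : x %/ e < m by rewrite ltn_divLR // -eM.
(* After [j] passes, [j] units of the top digit [x %/ e] have moved from position [L] to position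
   0. *)
pose F j := bank [:: N; a; m; M; t; i; x; m * (x %% e) + (x %/ e - j) * M + j; 0; fl i]
  (hp i) w.
have small : m * (x %% e) + m <= M by rewrite -mulnSr eM leq_mul2l xe orbT.
have mx : m * x = m * (x %% e) + x %/ e * M by rewrite {1}xE eM; ring.
rewrite (_ : bank _ _ _ = F 0); last by rewrite /F subn0 addn0 -mx.
eapply runs_conv; [apply: (@runs_while _ _ F (x %/ e) 1) | |].
- move=> j jm; rewrite /= -lt0n subn_gt0.
  rewrite -(subnSK jm) mulSn.
  by move: (M) ((_ - _) * M) (m * (x %% e)) => u z y; lia.
- by rewrite /=; apply/eqP; rewrite subn_eq0 subnn; lia.
- move=> j jm; eapply runs_conv; [exact: runs_set | | by []].
  rewrite /=/F -(subnSK jm) mulSn.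
  suff -> : m * (x %% e) + (M + (x %/ e - j.+1) * M) + j + 1 - M =
    m * (x %% e) + (x %/ e - j.+1) * M + j.+1 by [].
  by move: (M) ((_ - _) * M) (m * (x %% e)) => u z y; lia.
- by rewrite /F subnn addn0 /rot_digits expn1.
- have := leq_div x e; lia.
Qed.

(** The term [M * 7] bounds three loops: reduction modulo [N] (2), multiplication by [m] (3) and
    wrapping (2). *)
Definition step_time := M * 7 + ba + 13.

Let runs_step t q : t < M -> q < L ->
  runs (step_prog act)
    (bank [:: N; a; m; M; t; t * L + q; rot_digits m L q t; 0; 0; fl (t * L + q)]
       (hp (t * L + q)) w) step_time
    (bank [:: N; a; m; M; t; t * L + q.+1; rot_digits m L q.+1 t; 0; 0;
       fl (t * L + q.+1)] (hp (t * L + q.+1)) w).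
Proof.
move=> tM qL; set i := t * L + q.
have iT : i < L * M.
  have : t.+1 * L <= M * L by rewrite leq_mul2r tM orbT.
  by rewrite mulSn [L * M]mulnC /i; lia.
have vE : rotation_shift m L i = rot_digits m L q t.
  by rewrite /rotation_shift /i modnMDl divnMDl // modn_small // divn_small // addn0.
have xM : rot_digits m L q t < M by apply: rot_digits_lt => //; exact: ltnW.
have mM : m <= M by rewrite -[leqLHS]expn1 leq_pexp2l.
eapply runs_conv.
- run_set.
  eapply runs_seq; first exact: runs_mod.
  eapply runs_seq; first by rewrite -vE; exact: runs_act.
  run_set; run_set.
  eapply runs_seq; first exact: (@runs_mul 6).
  rewrite addn1.
  eapply runs_seq; first by rewrite vE; exact: runs_wrap.
  by run_set; exact: runs_set.
- by rewrite /= -rot_digitsS // /i -addnS.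
- rewrite /step_time; lia.
Qed.

Lemma runs_main : N <= M -> (forall j, j < m -> j ^ L < N) ->
  fl 0 = 0 ->
  runs (main_prog L act) (bank [:: N; a; 0; 0; 0; 0; 0; 0; 0; 0] (hp 0) w)
    (m * (L * (m * 3 + 4) + 4) + 1 + (M * (L * step_time + 5) + 1))
    (bank [:: N; a; m; M; M; L * M; 0; 0; 0; fl (L * M)] (hp (L * M)) w).
Proof.
move=> NM mlt fl0.
apply: runs_seq; first exact: runs_root.
pose F t := bank [:: N; a; m; M; t; t * L; 0; 0; 0; fl (t * L)] (hp (t * L)) w.
rewrite (_ : bank _ _ _ = F 0); last by rewrite /F mul0n fl0.
eapply runs_conv; [apply: (@runs_while _ _ F M (L * step_time + 4)) | |].
- by move=> t tM; rewrite /= -lt0n subn_gt0.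
- by rewrite /= subnn.
- move=> t tM; eapply runs_conv.
  + pose G q := bank [:: N; a; m; M; t; t * L + q; rot_digits m L q t; 0; 0;
      fl (t * L + q)] (hp (t * L + q)) w.
    have steps := @runs_repeat (step_prog act) G L _ (fun q => @runs_step t q tM).
    rewrite /F; run_set; eapply runs_seq.
      rewrite (_ : bank _ _ _ = G 0); last by rewrite /G addn0 rot_digits0.
      exact: steps.
    by rewrite /G; run_set; exact: runs_set.
  + by rewrite /= /F mulSnr addn1.
  + lia.
- by rewrite /F mulnC.
- lia.
Qed.

End Main.
End Runs.

(** * The sampler and the certifier *)

Definition schedule_prog (L : nat) : prog :=
  PSeq (main_prog L (PStore (EReg 5) (EReg 7))) (PSet 1 (EReg 5)).

(** The sum of the two truncated differences vanishes exactly when the entries agree. *)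
Definition mismatch : expr :=
  EAdd (ESub (EMem (EReg 5)) (EReg 7)) (ESub (EReg 7) (EMem (EReg 5))).

Definition check_prog (L : nat) : prog :=
  PSeq (main_prog L (PIf mismatch (PSet 9 (ECst 1)) PSkip))
    (PSet 0 (ESub (ECst 1)
       (EAdd (EAdd (ESub (EReg 1) (EReg 5)) (ESub (EReg 5) (EReg 1))) (EReg 9)))).

Section Correctness.
Variables (N L m : nat).
Hypotheses (N_gt1 : 1 < N) (L_gt0 : 0 < L) (NM : N <= m ^ L).
Hypothesis m_min : forall j, j < m -> j ^ L < N.

Let m_gt0 : 0 < m.
Proof. by case: m NM => //; rewrite exp0n //; lia. Qed.

Let value k := rotation_shift m L k %% N.

Lemma nth_rotation_schedule k : k < L * m ^ L ->
  nth 0%R (rotation_schedule N m L) k = value k :> nat.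
Proof. by move=> kT; rewrite nth_mkseq // val_Zp_nat. Qed.

Lemma schedule_prog_computes w :
  computes_shifts (schedule_prog L) w (rotation_schedule N m L).
Proof.
pose hp i k := if k < i then value k else 0.
have act t i x : i < L * m ^ L ->
    runs (PStore (EReg 5) (EReg 7))
     (bank [:: N; 0; m; m ^ L; t; i; x; value i; 0; 0] (hp i) w) 1
     (bank [:: N; 0; m; m ^ L; t; i; x; value i; 0; 0] (hp i.+1) w).
  move=> _; exists 1 => //.
  rewrite (_ : bank _ (hp i.+1) w = set_heap
    (bank [:: N; 0; m; m ^ L; t; i; x; value i; 0; 0] (hp i) w) i (value i)).
    exact: ExStore.
  congr State; apply/funext => k; rewrite /upd /hp /= ltnS leq_eqVlt.
  by case: eqP => [->|].
have [t _ e] := runs_seq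
  (runs_main L_gt0 (ltnW N_gt1) m_gt0 act NM m_min erefl) (runs_set _ _ _ 1 (EReg 5)).
exists t; eexists; split.
- rewrite (_ : State _ _ _ = bank [:: N; 0; 0; 0; 0; 0; 0; 0; 0; 0] (hp 0) w).
    exact: e.
  by congr State; apply/funext => -[|[|[|[|[|[|[|[|[|[|k]]]]]]]]]] //=; rewrite nth_nil.
- by rewrite size_mkseq muln_gt0 L_gt0 expn_gt0 m_gt0.
- by rewrite /= size_mkseq.
- by move=> i; rewrite size_mkseq => iT; rewrite nth_rotation_schedule //= /hp iT.
Qed.

Definition check_time :=
  m * (L * (m * 3 + 4) + 4) + 1 + (m ^ L * (L * (m ^ L * 7 + 2 + 13) + 5) + 1) + 1.

Lemma check_prog_decides (s : seq 'Z_N) : exists2 t, t <= check_time &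
  decides (check_prog L) s t (s == rotation_schedule N m L).
Proof.
(* The heap reads 0 past the end of [s]; a list of the wrong length is caught by the final length
   test. *)
pose hp k : nat := nth 0%R s k.
pose bad i := has (fun k => hp k != value k) (iota 0 i).
pose fl i : nat := bad i.
have act t i x : i < L * m ^ L ->
    runs (PIf mismatch (PSet 9 (ECst 1)) PSkip)
     (bank [:: N; size s; m; m ^ L; t; i; x; value i; 0; fl i] hp [::]) 2
     (bank [:: N; size s; m; m ^ L; t; i; x; value i; 0; fl i.+1] hp [::]).
  move=> _; have badS : bad i.+1 = bad i || (hp i != value i).
    by rewrite /bad -addn1 iotaD has_cat /= orbF add0n.
  set st := bank _ _ _; have mE : Defs.eval st mismatch =
    (hp i - value i) + (value i - hp i) by [].
  have [e|ne] := eqVneq (hp i) (value i).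
    have [t' t'1 et] := runs_skip st; exists t'.+1 => //.
    rewrite /fl badS e eqxx orbF; apply: ExIfF et.
    by rewrite mE e subnn.
  have [t' t'1 et] := runs_set
    [:: N; size s; m; m ^ L; t; i; x; value i; 0; fl i] hp [::] 9 (ECst 1).
  exists t'.+1 => //; rewrite /fl badS ne orbT; apply: ExIfT et.
  by rewrite mE; move: (hp i) (value i) ne => u v; lia.
have [t tle e] := runs_seq
  (runs_main L_gt0 (ltnW N_gt1) m_gt0 act NM m_min erefl)
  (runs_set _ _ _ 0 (ESub (ECst 1)
       (EAdd (EAdd (ESub (EReg 1) (EReg 5)) (ESub (EReg 5) (EReg 1))) (EReg 9)))).
exists t => //; eexists; split.
  rewrite (_ : State _ _ _ = bank [:: N; size s; 0; 0; 0; 0; 0; 0; 0; 0] hp [::]).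
    exact: e.
  by congr State; apply/funext => -[|[|[|[|[|[|[|[|[|[|k]]]]]]]]]] //=; rewrite nth_nil.
rewrite /=; set T := L * m ^ L.
have -> : (s == rotation_schedule N m L) = (size s == T) && (fl T == 0).
  apply/eqP/andP => [sE|[/eqP sT fT]].
    rewrite sE size_mkseq eqxx /fl; split=> //; rewrite eqb0.
    apply/hasPn => k; rewrite mem_iota add0n => /andP[_ kT].
    by rewrite negbK /hp sE nth_rotation_schedule.
  apply: (@eq_from_nth _ 0%R) => [|k kT]; first by rewrite size_mkseq.
  rewrite sT in kT; apply: val_inj; rewrite /= nth_rotation_schedule //.
  move: fT; rewrite eqb0 => /hasPn /(_ k); rewrite mem_iota add0n kT => /(_ isT).
  by rewrite negbK => /eqP.
have : fl T <= 1 by rewrite /fl leq_b1.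
by case: eqP => [->|]; lia.
Qed.

Lemma check_prog_accepts (s : seq 'Z_N) :
  accepts (check_prog L) s <-> s = rotation_schedule N m L.
Proof.
have [t' _ [st' [e' b']]] := check_prog_decides s; split=> [[t [st [e b]]]|sE].
  by have [_ ee] := exec_det e e'; apply/eqP; rewrite b' -ee -b.
by exists t', st'; split=> //; rewrite -b' sE eqxx.
Qed.

(** Minimality of [m] gives [(m - 1) ^ L < N], and [m <= 2 * (m - 1)], so [m ^ L <= 2 ^ L * N]. *)
Lemma check_time_le : 1 < m ->
  check_time <= (29 * L + 12) * (2 ^ L) ^ 2 * N ^ 2.
Proof.
move=> m_gt1; set M := m ^ L.
have mM : m <= M by rewrite -[leqLHS]expn1 leq_pexp2l.
have M2N : M <= 2 ^ L * N.
  apply: (@leq_trans (2 ^ L * m.-1 ^ L)).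
    by rewrite -expnMn leq_exp2r //; lia.
  by rewrite leq_mul2l ltnW ?orbT // m_min; lia.
apply: (@leq_trans ((29 * L + 12) * M ^ 2)); last first.
  by rewrite -mulnA leq_mul2l -expnMn leq_exp2r // M2N orbT.
rewrite /check_time -/M expnS expn1.
(* In units of [M ^ 2] the root search costs [7 * L + 4], the main loop [22 * L + 5], and the
   remaining steps 3. *)
have h1 : m * (L * (m * 3 + 4) + 4) <= M * (L * (M * 3 + 4 * M) + 4 * M).
  by apply: leq_mul => //; apply: leq_add; [apply: leq_mul => //|]; lia.
have h2 : M * (L * (M * 7 + 2 + 13) + 5) <= M * (L * (M * 7 + 15 * M) + 5 * M).
  by apply: leq_mul => //; apply: leq_add; [apply: leq_mul => //|]; lia.
have h3 : 1 <= M * M by rewrite muln_gt0; lia.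
lia.
Qed.

End Correctness.

Lemma root_exists (L N : nat) : 0 < L ->
  exists m, N <= m ^ L /\ forall j, j < m -> j ^ L < N.
Proof.
move=> L_gt0; have ex : exists m, N <= m ^ L.
  by exists N; case: N => // n; rewrite -[leqLHS]expn1 leq_pexp2l.
exists (ex_minn ex); case: ex_minnP => m Nm mmin; split=> // j jm.
by rewrite ltnNge; apply/negP => /mmin; rewrite leqNgt jm.
Qed.

End Programs.

(** * Estimates for the integer root, and the theorem *)

Lemma bernoulli (R : realFieldType) (x : R) n : 0 <= x <= 1 ->
  1 - n%:R * x <= (1 - x) ^+ n.
Proof.
move=> /andP[x0 x1]; elim: n => [|n IH]; first by rewrite mul0r subr0.
rewrite exprS -natr1; have h1 : 0 <= 1 - x by lra.
apply: le_trans (ler_wpM2l h1 IH).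
have : 0 <= n%:R * x * x by rewrite !mulr_ge0.
lra.
Qed.

(** By Bernoulli, [(m - 1) ^ L] is at least [(1 - L / m) * m ^ L], and [L / m <= eps]. *)
Lemma root_ratio (R : realFieldType) (eps : R) (L N m : nat) : (0 < m)%N ->
  L%:R <= eps * m%:R -> (m.-1 ^ L < N)%N -> (1 - eps) * (m ^ L)%:R <= N%:R.
Proof.
move=> m_gt0 mL mN; have mR : 0 < m%:R :> R by rewrite ltr0n.
apply: (@le_trans _ _ (m.-1 ^ L)%:R); last by rewrite ler_nat ltnW.
have m1 : m.-1%:R = (1 - m%:R^-1) * m%:R :> R.
  by rewrite mulrBl mul1r mulVf ?gt_eqF // -{2}(prednK m_gt0) -natr1 addrK.
rewrite !natrX m1 exprMn ler_wpM2r ?exprn_ge0 //.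
have x01 : 0 <= (m%:R^-1 : R) <= 1 by rewrite invr_ge0 ler0n invf_le1 // ler1n.
apply: le_trans (bernoulli L x01); rewrite lerD2l lerN2.
by rewrite ler_pdivrMr.
Qed.

Lemma root_le_powR (R : realType) (x h N : nat) : (0 < h)%N -> (x ^ h <= N)%N ->
  x%:R <= N%:R `^ (h%:R^-1) :> R.
Proof.
move=> h_gt0 xN; have hR : h%:R != 0 :> R by rewrite pnatr_eq0; lia.
have -> : x%:R = (x%:R ^+ h) `^ h%:R^-1 :> R.
  by rewrite -powR_mulrn // -powRrM divff // powRr1.
by rewrite ge0_ler_powR ?invr_ge0 ?nnegrE ?exprn_ge0 // -natrX ler_nat.
Qed.

Theorem theorem8 (R : realType) (eps : R) (heps : 0 < eps) (L : nat) :
  exists C : R,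
  forall (l : nat) (h : 'I_l -> nat),
    (0 < l)%N ->
    (forall j, (0 < h j)%N) ->
    (\big[lcmn/1%N]_(j < l) h j)%N = L ->
  exists (A B : prog) (c d N0 : nat),
  forall N : nat, (1 < N)%N -> (N0 <= N)%N ->
    (exists k : nat,
       (forall w : k.-tuple bool, exists s : seq 'Z_N,
          computes_shifts A w s /\
          exists (t : nat) (b : bool),
            (t <= c * N ^ d)%N /\ decides B s t b) /\
       1 / 2 <=
         #|[pred w : k.-tuple bool |
              `[< exists s : seq 'Z_N, computes_shifts A w s /\ accepts B s >]]|%:R
         / #|{: k.-tuple bool}|%:R :> R) /\
    (forall s : seq 'Z_N, (0 < size s)%N -> accepts B s ->
       forall j : 'I_l,
       exists f : dipath 'Z_N -> R,
         [/\ oblivious_routing_protocol (shift_schedule s) f,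
             guarantees_throughput (shift_schedule s) f
               (1 / (2 * (h j)%:R) * (1 - eps)) &
             max_latency_le (shift_schedule s) f
               (C * (h j)%:R * (N%:R `^ ((h j)%:R^-1)))]).
Proof.
(* The latency is at most [3 * L * m ^ g], and [m ^ g <= 2 ^ L * (m - 1) ^ g], where [(m - 1) ^ g]
   is at most the [h j]-th root of [N]. *)
exists (3 * L%:R * 2 ^+ L) => l h l_gt0 h_gt0 lcmE.
have L_gt0 : (0 < L)%N.
  rewrite -lcmE; apply: (big_ind (fun x => (0 < x)%N)) => // x y x0 y0.
  by rewrite lcmn_gt0 x0.
(* For [N >= m0 ^ L] the root [m] is at least [m0], hence [L <= eps * m]. *)
pose m0 := (Num.truncn (L%:R / eps)).+1.
have m0L : L%:R / eps < m0%:R :> R by rewrite truncnS_gt.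
exists (schedule_prog L), (check_prog L), ((29 * L + 12) * (2 ^ L) ^ 2)%N, 2%N,
  (m0 ^ L)%N => N N_gt1 N0N.
have [m [NM m_min]] := root_exists N L_gt0.
have m_gt1 : (1 < m)%N.
  rewrite ltnNge; apply/negP => m1; have : (m ^ L <= 1 ^ L)%N by rewrite leq_exp2r.
  by rewrite exp1n => /(leq_trans NM); rewrite leqNgt N_gt1.
split.
  (* With zero coins the sample space has a single point, and the success probability is 1. *)
  exists 0%N; split=> [w|].
    exists (rotation_schedule N m L); split; first exact: schedule_prog_computes.
    have [t tle dec] := check_prog_decides N_gt1 L_gt0 NM m_min (rotation_schedule N m L).
    exists t, true; rewrite eqxx in dec; split=> //.
    by apply: (leq_trans tle); apply: (check_time_le (N := N)).
  rewrite (@eq_card _ _ predT) => [|w]; last first.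
    rewrite !inE; apply/asboolP; exists (rotation_schedule N m L); split.
      exact: schedule_prog_computes.
    by apply/(check_prog_accepts N_gt1 L_gt0 NM m_min).
  by rewrite card_tuple expn0 divr1; lra.
move=> s _ /(check_prog_accepts N_gt1 L_gt0 NM m_min) -> j.
have hL : (h j %| L)%N by rewrite -lcmE (biglcmn_sup j).
set g := (L %/ h j)%N.
have Lgh : L = (g * h j)%N by rewrite divnK.
have g_gt0 : (0 < g)%N by rewrite divn_gt0 // dvdn_leq.
have m_gt0 : (0 < m)%N by exact: ltnW.
have NM' := NM; rewrite Lgh in NM'.
have m1N : (m.-1 ^ L < N)%N by apply: m_min; lia.
have ratio : (1 - eps) * (m ^ (g * h j))%:R <= N%:R.
  rewrite -Lgh; apply: root_ratio => //.
  have : (m0 <= m)%N by rewrite -(leq_exp2r _ _ L_gt0) (leq_trans N0N).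
  rewrite -(ler_nat R) => /(lt_le_trans m0L) /ltW.
  by rewrite ler_pdivrMr // mulrC.
have [f [f1 f2 f3]] := rotation_routing N_gt1 m_gt0 g_gt0 (h_gt0 j) NM' ratio.
rewrite -Lgh in f1 f2 f3.
exists f; split=> // p fp; apply: le_trans (f3 p fp) _.
have root : (m.-1 ^ g)%:R <= N%:R `^ ((h j)%:R^-1) :> R.
  by apply: root_le_powR => //; rewrite -expnM -Lgh ltnW.
have W2 : (m ^ g <= 2 ^ L * m.-1 ^ g)%N.
  apply: (@leq_trans (2 ^ g * m.-1 ^ g)).
    by rewrite -expnMn leq_exp2r //; lia.
  by rewrite leq_mul2r leq_pexp2l ?orbT // leq_div.
have W2R : (m ^ g)%:R <= 2 ^+ L * (m.-1 ^ g)%:R :> R.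
  by rewrite -natrX -natrM ler_nat.
have h1 : 1 <= (h j)%:R :> R by rewrite ler1n.
set y := _ `^ _ in root *.
rewrite !natrM -!mulrA ler_wpM2l // ler_wpM2l //.
apply: le_trans W2R _; rewrite ler_wpM2l ?exprn_ge0 //.
by apply: le_trans root _; rewrite ler_peMl ?powR_ge0.
Qed.
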